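(* Let $w=t_\lambda\bar w\in\mathrm{Adm}_{G_r}(\mu)$ and let $J\subseteq\Phi$ be a root subsystem. For any path $\Delta$ in $B_{J_{\mathrm{aff}}}^\prec(w,t_\lambda)$, there is a unique minimal root subsystem $J_\Delta\subseteq J$ such that all reflections $t_i\in E(\Delta)$ lie in $W_{J_\Delta}$.
   Context: $G$ is a split connected reductive group over a non-archimedean local field, $T\subset B$ a split maximal torus and Borel, $\Phi=\Phi(G,T)$, $W$ the finite Weyl group. $\widetilde W=X_*(T)\rtimes W=W_{\mathrm{aff}}\rtimes\Omega$ is the extended affine Weyl group, $W_{\mathrm{aff}}$ being the Coxeter group generated by reflections in the walls of the base alcove (in the $B$-positive chamber, origin in closure) and $\Omega$ the stabilizer of that alcove; length and Bruhat order are extended to $\widetilde W$ with $\Omega$ in length $0$ and $\sigma u\le\sigma'u'$ iff $\sigma=\sigma'$, $u\le u'$. $\mu\in X_*(T)$ is dominant and minuscule ($\langle\mu,\alpha\rangle\in\{-1,0,1\}$ for all $\alpha\in\Phi$); $\mathrm{Adm}_{G_r}(\mu)=\{w\in\widetilde W:w\le t_\eta\text{ for some }\eta\in W\mu\}$; $w=t_\lambda\bar w$ with $\lambda\in X_*(T)$, $\bar w\in W$. A root subsystem is a subset $J\subseteq\Phi$ with $s_\alpha(J)=J$ for $\alpha\in J$; $W_J=\langle s_\alpha:\alpha\in J\rangle\subset W$, and $W_{J,\mathrm{aff}}\subset W_{\mathrm{aff}}$ is the group generated by the affine reflections $s_{\alpha+k}$, $\alpha\in J$, $k\in\mathbb Z$.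 A path $\Delta$ from $w$ to $t_\lambda$ in the Bruhat graph of $W_{\mathrm{aff}}$ is a sequence of affine reflections $t_1,\dots,t_n\in W_{\mathrm{aff}}$ with $w<wt_1<\dots<wt_1\cdots t_n=t_\lambda$ (here $w,t_\lambda\in\sigma W_{\mathrm{aff}}$ for one $\sigma\in\Omega$); $E(\Delta)=\{t_1,\dots,t_n\}$. $\prec$ is a fixed reflection ordering on the reflections of $W_{\mathrm{aff}}$: a total order on the positive affine roots such that whenever $\alpha,\beta,a\alpha+b\beta$ are positive roots with $a,b>0$ real, either $\alpha\prec a\alpha+b\beta\prec\beta$ or $\beta\prec a\alpha+b\beta\prec\alpha$. $B_{J_{\mathrm{aff}}}^\prec(w,t_\lambda)$ is the set of such paths with $E(\Delta)\subset W_{J,\mathrm{aff}}$ and $t_1\prec t_2\prec\dots\prec t_n$. *)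

(* Defs.v *)
From Stdlib Require Export Relation_Operators.
From HB Require Import structures.
From mathcomp Require Export all_boot all_order all_algebra finmap.
From mathcomp Require Export boolp classical_sets reals.

Set Implicit Arguments.
Unset Strict Implicit.
Unset Printing Implicit Defensive.

Import Order.TTheory GRing.Theory Num.Theory.

Local Open Scope fset_scope.
Local Open Scope ring_scope.

(* The split group enters only through its root datum.  Fixing a Z-basis of   *)
(* X_*(T) and the dual basis of X^*(T), cocharacters are integer columns,     *)
(* characters are integer rows, and the perfect pairing is the matrix product.*)

Definition pair (K : pzRingType) n (a : 'rV[K]_n) (x : 'cV[K]_n) : K :=
  (a *m x) ord0 ord0.

(* x |-> x - <a, x> c on columns (acting on the left), and                    *)
(* b |-> b - <b, c> a on rows (acting on the right).                          *)
Definition refl_mx n (a : 'rV[int]_n) (c : 'cV[int]_n) : 'M[int]_n :=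
  1%:M - c *m a.

(* Reduced root data; [coroot] is only meaningful on [Phi]. *)
Record root_datum n := RootDatum {
  Phi : {fset 'rV[int]_n};
  coroot : 'rV[int]_n -> 'cV[int]_n;
  coroot_inj : {in Phi &, injective coroot};
  pair_coroot : forall a, a \in Phi -> pair a (coroot a) = 2;
  refl_Phi : forall a, a \in Phi ->
    [fset b *m refl_mx a (coroot a) | b in Phi] = Phi;
  refl_coroots : forall a, a \in Phi ->
    [fset refl_mx a (coroot a) *m coroot b | b in Phi]
      = [fset coroot b | b in Phi];
  Phi_reduced : forall a, a \in Phi -> a *+ 2 \notin Phi
}.

(* Borel subgroups containing T correspond to systems of positive roots, i.e. *)
(* to the sets {a | <a, xi> > 0} for a regular cocharacter xi.                *)
Definition positive_system n (D : root_datum n) (P : {fset 'rV[int]_n}) : Prop :=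
  exists xi : 'cV[int]_n,
    (forall a, a \in Phi D -> pair a xi != 0) /\
    (forall a, (a \in P) = (a \in Phi D) && (0 < pair a xi)).

Definition dominant n (P : {fset 'rV[int]_n}) (mu : 'cV[int]_n) : Prop :=
  forall a, a \in P -> 0 <= pair a mu.

Definition minuscule n (D : root_datum n) (mu : 'cV[int]_n) : Prop :=
  forall a, a \in Phi D -> pair a mu \in [:: -1; 0; 1].

Definition root_subsystem n (D : root_datum n) (J : {fset 'rV[int]_n}) : Prop :=
  J `<=` Phi D /\
  forall a, a \in J -> [fset b *m refl_mx a (coroot D a) | b in J] = J.

(* (lam, u) is the affine transformation x |-> lam + u x. *)
Definition aff n := ('cV[int]_n * 'M[int]_n)%type.

Definition aff1 n : aff n := (0, 1%:M).

Definition affM n (x y : aff n) : aff n := (x.1 + x.2 *m y.1, x.2 *m y.2).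

Definition transl n (lam : 'cV[int]_n) : aff n := (lam, 1%:M).

Definition aff_act (R : realType) n (x : aff n) (v : 'cV[R]_n) : 'cV[R]_n :=
  map_mx intr x.1 + map_mx intr x.2 *m v.

Definition word_prod n (ts : seq (aff n)) : aff n := foldr (@affM n) (aff1 n) ts.

Definition is_word n (S : aff n -> Prop) (ts : seq (aff n)) (x : aff n) : Prop :=
  (forall t, t \in ts -> S t) /\ word_prod ts = x.

(* The generated subgroup; words without inverses suffice because S will      *)
(* always consist of involutions.                                             *)
Definition gen n (S : aff n -> Prop) (x : aff n) : Prop :=
  exists ts, is_word S ts x.

(* (a, k) is the affine function a + k. *)
Definition aff_root n := ('rV[int]_n * int)%type.

Definition is_aff_root n (D : root_datum n) (b : aff_root n) : Prop :=
  b.1 \in Phi D.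

Definition aff_eval (R : realType) n (b : aff_root n) (v : 'cV[R]_n) : R :=
  pair (map_mx intr b.1) v + b.2%:~R.

(* s_{a+k} : v |-> v - (<a, v> + k) a^vee *)
Definition aff_refl n (D : root_datum n) (b : aff_root n) : aff n :=
  (- (b.2 *: coroot D b.1), refl_mx b.1 (coroot D b.1)).

(* W_J, inside the extended affine Weyl group as stabilizer of the origin. *)
Definition finW n (D : root_datum n) (J : {fset 'rV[int]_n}) : aff n -> Prop :=
  gen (fun t => exists2 a, a \in J & t = aff_refl D (a, 0)).

(* W_{J,aff} *)
Definition affW n (D : root_datum n) (J : {fset 'rV[int]_n}) : aff n -> Prop :=
  gen (fun t => exists2 b : aff_root n, b.1 \in J & t = aff_refl D b).

Definition extW n (D : root_datum n) (x : aff n) : Prop :=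
  exists lam wbar, finW D (Phi D) wbar /\ x = affM (transl lam) wbar.

Section BruhatOrder.
Variables (R : realType) (n : nat) (D : root_datum n) (P : {fset 'rV[int]_n}).

Definition base_alcove : set 'cV[R]_n :=
  [set v | forall a, a \in P -> 0 < pair (map_mx intr a) v < 1]%classic.

Definition closed_base_alcove : set 'cV[R]_n :=
  [set v | forall a, a \in P -> 0 <= pair (map_mx intr a) v <= 1]%classic.

Definition positive_aff_root (b : aff_root n) : Prop :=
  is_aff_root D b /\ forall v, base_alcove v -> 0 < aff_eval b v.

(* The hyperplane of b is a wall when it supports a facet of the alcove: some *)
(* point of the closure lies on this hyperplane of the arrangement only.      *)
Definition is_wall (b : aff_root n) : Prop :=
  is_aff_root D b /\
  exists v : 'cV[R]_n, [/\ closed_base_alcove v, aff_eval b v = 0 &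
    forall c : aff_root n, is_aff_root D c -> aff_eval c v = 0 ->
      c = b \/ c = (- b.1, - b.2)].

Definition simple_refl (s : aff n) : Prop :=
  exists2 b, is_wall b & s = aff_refl D b.

Definition Waff : aff n -> Prop := gen simple_refl.

Definition Omega (x : aff n) : Prop :=
  extW D x /\ (aff_act x @` base_alcove = base_alcove)%classic.

Definition has_word_of_size (x : aff n) (k : nat) : Prop :=
  exists2 ts, size ts = k & is_word simple_refl ts x.

(* Coxeter length on Waff (junk value 0 elsewhere). *)
Definition len (x : aff n) : nat :=
  match pselect (exists k, `[< has_word_of_size x k >]) with
  | left h => ex_minn h
  | right _ => 0%N
  end.

Definition reflection (t : aff n) : Prop :=
  Waff t /\ exists2 b, is_aff_root D b & t = aff_refl D b.

Definition bruhat_edge (u v : aff n) : Prop :=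
  [/\ Waff u, Waff v, (len u < len v)%N & exists2 t, reflection t & v = affM u t].

Definition bruhat_aff (u v : aff n) : Prop :=
  [/\ Waff u, Waff v & clos_refl_trans _ bruhat_edge u v].

Definition bruhat_le (x y : aff n) : Prop :=
  exists sigma u v, [/\ Omega sigma, x = affM sigma u, y = affM sigma v
    & bruhat_aff u v].

Definition bruhat_lt (x y : aff n) : Prop := bruhat_le x y /\ x <> y.

Definition Adm (mu : 'cV[int]_n) (w : aff n) : Prop :=
  extW D w /\
  exists2 v, finW D (Phi D) v & bruhat_le w (transl (v.2 *m mu)).

(* w < w t_1 < ... < w t_1 ... t_n = y *)
Fixpoint bruhat_path (w : aff n) (ts : seq (aff n)) (y : aff n) : Prop :=
  match ts with
  | [::] => w = y
  | t :: ts' => [/\ reflection t, bruhat_lt w (affM w t)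
                  & bruhat_path (affM w t) ts' y]
  end.

(* The betweenness condition is void unless b <> c: for b = c it would read   *)
(* b < b when x + y = 1.                                                      *)
Record reflection_order (prec : aff_root n -> aff_root n -> Prop) : Prop := {
  prec_irr : forall b, positive_aff_root b -> ~ prec b b;
  prec_trans : forall b c d,
    positive_aff_root b -> positive_aff_root c -> positive_aff_root d ->
    prec b c -> prec c d -> prec b d;
  prec_total : forall b c,
    positive_aff_root b -> positive_aff_root c -> b <> c ->
    prec b c \/ prec c b;
  prec_between : forall (b c d : aff_root n) (x y : R),
    positive_aff_root b -> positive_aff_root c -> positive_aff_root d ->
    b <> c -> 0 < x -> 0 < y ->
    map_mx intr d.1 = x *: map_mx intr b.1 + y *: map_mx intr c.1 ->
    d.2%:~R = x * b.2%:~R + y * c.2%:~R ->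
    (prec b d /\ prec d c) \/ (prec c d /\ prec d b)
}.

Definition refl_prec (prec : aff_root n -> aff_root n -> Prop)
    (s t : aff n) : Prop :=
  exists b c, [/\ positive_aff_root b, positive_aff_root c,
    s = aff_refl D b, t = aff_refl D c & prec b c].

Fixpoint increasing (prec : aff_root n -> aff_root n -> Prop)
    (ts : seq (aff n)) : Prop :=
  match ts with
  | s :: ((t :: _) as ts') => refl_prec prec s t /\ increasing prec ts'
  | _ => True
  end.

(* B_{J_aff}^prec(w, y); a path is the sequence of its reflections. *)
Definition BJ (prec : aff_root n -> aff_root n -> Prop) (J : {fset 'rV[int]_n})
    (w y : aff n) (ts : seq (aff n)) : Prop :=
  [/\ bruhat_path w ts y, (forall t, t \in ts -> affW D J t)
    & increasing prec ts].

End BruhatOrder.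

(* K is a root subsystem inside J with all the t_i in W_K *)
Definition carries n (D : root_datum n) (J : {fset 'rV[int]_n})
    (ts : seq (aff n)) (K : {fset 'rV[int]_n}) : Prop :=
  [/\ root_subsystem D K, K `<=` J & forall t, t \in ts -> finW D K t].

Definition minimal_carrier n (D : root_datum n) (J : {fset 'rV[int]_n})
    (ts : seq (aff n)) (K : {fset 'rV[int]_n}) : Prop :=
  carries D J ts K /\ forall K', carries D J ts K' -> K' `<=` K -> K' = K.

(* Main.v *)
(** The reflections of a path from [t_lam wbar] to [t_lam] all fix the origin.
    If [x < y = s_c x], with the affine roots [c] and [x^-1 c] positive, and
    [y(0)] is minuscule, then [c(x(0)) >= 0] is an integer [k] and [c(0) >= 0],
    so minusculity forces either [k = 0], i.e. [x(0) = y(0)], or [k = 1] and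
    [c(0) = 0], in which case [x(0) = y(0) + a^vee] is again minuscule, for a
    positive root [a].  So going up the Bruhat order [x(0)] can only move down
    by positive coroots, and a path whose two ends send [0] to [lam] never moves
    it.  Each [t_i] is therefore some [s_a] with [a] in [Phi], and [s_a] lies in
    [W_K] iff [a] lies in [K]; root subsystems containing prescribed roots are
    stable under intersection. *)

Require Import Defs.
From mathcomp Require Import zify ring lra.

Set Implicit Arguments.
Unset Strict Implicit.
Unset Printing Implicit Defensive.

Import Order.TTheory GRing.Theory Num.Theory.

Local Open Scope fset_scope.
Local Open Scope ring_scope.

(** * The pairing and reflection matrices *)

Section Pairing.
Variables (K : comPzRingType) (n : nat).
Implicit Types (a b : 'rV[K]_n) (x y : 'cV[K]_n).

Lemma pairDl a b x : pair (a + b) x = pair a x + pair b x.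
Proof. by rewrite /pair mulmxDl mxE. Qed.

Lemma pairDr a x y : pair a (x + y) = pair a x + pair a y.
Proof. by rewrite /pair mulmxDr mxE. Qed.

Lemma pairNl a x : pair (- a) x = - pair a x.
Proof. by rewrite /pair mulNmx mxE. Qed.

Lemma pairNr a x : pair a (- x) = - pair a x.
Proof. by rewrite /pair mulmxN mxE. Qed.

Lemma pairZl k a x : pair (k *: a) x = k * pair a x.
Proof. by rewrite /pair -scalemxAl mxE. Qed.

Lemma pairZr k a x : pair a (k *: x) = k * pair a x.
Proof. by rewrite /pair -scalemxAr mxE. Qed.

Lemma pair0r a : pair a 0 = 0.
Proof. by rewrite /pair mulmx0 mxE. Qed.

Lemma pair_mulmx a (M : 'M[K]_n) x : pair (a *m M) x = pair a (M *m x).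
Proof. by rewrite /pair mulmxA. Qed.

Lemma pair_delta a i : pair a (delta_mx i 0) = a 0 i.
Proof.
rewrite /pair mxE (bigD1 i) //= big1 ?addr0 ?mxE ?eqxx ?mulr1 //.
by move=> j /negPf ji; rewrite mxE ji mulr0.
Qed.

Lemma outer_mulmx x a y : x *m a *m y = pair a y *: x.
Proof. by rewrite -mulmxA [a *m y]mx11_scalar mul_mx_scalar. Qed.

Lemma mulmx_outer a x b : a *m (x *m b) = pair a x *: b.
Proof. by rewrite mulmxA [a *m x]mx11_scalar mul_scalar_mx. Qed.

End Pairing.

Section Reflections.
Variable n : nat.
Implicit Types (a b : 'rV[int]_n) (c x y : 'cV[int]_n).

Definition pairE := (pairDl, pairDr, pairNl, pairNr, pairZl, pairZr).

Lemma mul_refl a c x : refl_mx a c *m x = x - pair a x *: c.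
Proof. by rewrite /refl_mx mulmxBl mul1mx outer_mulmx. Qed.

Lemma refl_mul b a c : b *m refl_mx a c = b - pair b c *: a.
Proof. by rewrite /refl_mx mulmxBr mulmx1 mulmx_outer. Qed.

Lemma refl_mxNN a c : refl_mx (- a) (- c) = refl_mx a c.
Proof. by rewrite /refl_mx mulmxN mulNmx opprK. Qed.

Lemma refl_mxK a c : pair a c = 2 -> refl_mx a c *m refl_mx a c = 1%:M.
Proof.
move=> ac; rewrite {2}/refl_mx mulmxBr mulmx1 mulmxA mul_refl ac.
by rewrite scaler_nat mulr2n opprD addNKr mulNmx opprK /refl_mx subrK.
Qed.

Lemma refl_mx_conj (s : 'M[int]_n) a c : s *m s = 1%:M ->
  refl_mx a (s *m c) = s *m refl_mx (a *m s) c *m s.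
Proof.
move=> ss; rewrite /refl_mx mulmxBr mulmx1 mulmxBl ss; congr (_ - _).
by rewrite -!mulmxA ss mulmx1.
Qed.

End Reflections.

Lemma imfset_fin_surj (T : choiceType) (A : {fset T}) (f : T -> T) :
  injective f -> (forall x, x \in A -> f x \in A) -> [fset f x | x in A] = A.
Proof.
move=> f_inj fA; apply/eqP; rewrite eqEfcard card_imfset // leqnn andbT.
by apply/fsubsetP => _ /imfsetP[x /= xA ->]; apply: fA.
Qed.

(** * Coroots and the finite Weyl group *)

Section Coroots.
Variables (n : nat) (D : root_datum n).
Implicit Types (a b : 'rV[int]_n) (c x y : 'cV[int]_n) (M : 'M[int]_n).

Lemma refl_root a b : a \in Phi D -> b \in Phi D ->
  b *m refl_mx a (coroot D a) \in Phi D.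
Proof. by move=> /(refl_Phi) {2}<- bP; apply/imfsetP; exists b. Qed.

Lemma subsystem_refl (K : {fset 'rV[int]_n}) a b : root_subsystem D K ->
  a \in K -> b \in K -> b *m refl_mx a (coroot D a) \in K.
Proof. by move=> [_ KK] /(KK) {2}<- bK; apply/imfsetP; exists b. Qed.

Lemma subsystem_root (K : {fset 'rV[int]_n}) a : root_subsystem D K ->
  a \in K -> a \in Phi D.
Proof. by move=> [/fsubsetP + _]; apply. Qed.

Lemma Phi_subsystem : root_subsystem D (Phi D).
Proof. by split=> // a; apply: refl_Phi. Qed.

Lemma subsystemN (K : {fset 'rV[int]_n}) a : root_subsystem D K ->
  (- a \in K) = (a \in K).
Proof.
move=> hK; suff h b : b \in K -> - b \in K.
  by apply/idP/idP => /h; rewrite ?opprK.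
move=> bK; move: (subsystem_refl hK bK bK).
rewrite refl_mul pair_coroot ?(subsystem_root hK) //.
by rewrite scaler_nat mulr2n opprD addNKr.
Qed.

Lemma PhiN a : (- a \in Phi D) = (a \in Phi D).
Proof. exact: subsystemN Phi_subsystem. Qed.

Definition is_coroot c := exists2 a, a \in Phi D & c = coroot D a.

Lemma refl_is_coroot a c : a \in Phi D -> is_coroot c ->
  is_coroot (refl_mx a (coroot D a) *m c).
Proof.
move=> aP [b bP ->]; have: refl_mx a (coroot D a) *m coroot D b
    \in [fset coroot D b | b in Phi D].
  by rewrite -(refl_coroots aP); apply/imfsetP; exists b.
by case/imfsetP => d /= dP ->; exists d.
Qed.

(* If [c] and [c0 = coroot a] differ, the product of the two reflections is a *)
(* nontrivial transvection: it moves [c0] to infinitely many coroots          *)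
(* [c0 + 2k (c - c0)].                                                        *)
Lemma coroot_unique a c : a \in Phi D -> pair a c = 2 ->
  (forall d, is_coroot d -> is_coroot (refl_mx a c *m d)) -> c = coroot D a.
Proof.
move=> aP ac cstab; set c0 := coroot D a.
have orbit k : is_coroot (c0 + k%:R *: (2 *: (c - c0))).
  elim: k => [|k ihk]; first by rewrite scale0r addr0; exists a.
  have := cstab _ (refl_is_coroot aP ihk).
  rewrite -/c0 [refl_mx a c0 *m _]mul_refl mul_refl !pairE ac (pair_coroot aP).
  rewrite subrr !mulr0 addr0 => h; congr is_coroot: h.
  apply/matrixP => i j; rewrite !mxE -[k.+1]addn1 natrD; ring.
apply/eqP; rewrite -subr_eq0; apply/negPn/negP => /cV0Pn[r cneq].
pose f (i : 'I_(#|` Phi D|).+1) := c0 + i%:R *: (2 *: (c - c0)).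
have f_inj : injective f.
  move=> i j /addrI/colP/(_ r); rewrite mxE [RHS]mxE.
  move/mulIf => h; apply/val_inj/eqP; rewrite -(eqr_nat int); apply/eqP/h.
  by rewrite mxE mulf_neq0.
have: (#|` [fset f i | i in 'I_(#|` Phi D|).+1]| <= #|` Phi D|)%N.
  apply: (@leq_trans #|` [fset coroot D b | b in Phi D]|).
    apply/fsubset_leq_card/fsubsetP => _ /imfsetP[i _ ->].
    by have [b bP e] := orbit i; apply/imfsetP; exists b.
  by rewrite card_in_imfset //; apply: coroot_inj.
by rewrite card_imfset // size_enum_ord ltnn.
Qed.

Lemma corootN a : a \in Phi D -> coroot D (- a) = - coroot D a.
Proof.
move=> aP; have NaP : - a \in Phi D by rewrite PhiN.
rewrite -[LHS]opprK; congr (- _); apply: coroot_unique => //.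
  by rewrite pairNr -pairNl pair_coroot.
move=> d dP; rewrite -[X in refl_mx X _]opprK refl_mxNN.
exact: refl_is_coroot.
Qed.

(** Matrices act on rows from the right, so for invertible [M] the row [a *m M] is the character
    [M^-1 a]; the second condition is equivariance of the coroot map. *)
Definition weyl_half M := forall a, a \in Phi D ->
  a *m M \in Phi D /\ M *m coroot D (a *m M) = coroot D a.

(* Of the finite Weyl group, only compatibility with [Phi] and [coroot] is     *)
(* needed; the inverse is carried along with each matrix.                     *)
Definition weyl M := weyl_half M /\
  exists N, [/\ weyl_half N, M *m N = 1%:M & N *m M = 1%:M].

Lemma weyl_half1 : weyl_half 1%:M.
Proof. by move=> a aP; rewrite mulmx1 mul1mx. Qed.

Lemma weyl1 : weyl 1%:M.
Proof.
by split; [|exists 1%:M; rewrite mulmx1; split=> //]; apply: weyl_half1.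
Qed.

Lemma weyl_halfM M N : weyl_half M -> weyl_half N -> weyl_half (M *m N).
Proof.
move=> hM hN a aP; have [aM eM] := hM _ aP; have [aN eN] := hN _ aM.
by rewrite mulmxA -[M *m N *m _]mulmxA eN eM.
Qed.

Lemma weylM M N : weyl M -> weyl N -> weyl (M *m N).
Proof.
move=> [hM [M' [hM' MM' M'M]]] [hN [N' [hN' NN' N'N]]].
split; first exact: weyl_halfM.
exists (N' *m M'); split; first exact: weyl_halfM.
  by rewrite mulmxA -(mulmxA M) NN' mulmx1.
by rewrite mulmxA -(mulmxA N') M'M mulmx1.
Qed.

(** The axioms only say that [s] permutes the roots and permutes the coroots. That the two
    permutations match comes from [coroot_unique]: the reflection built from [b] and
    [s *m coroot D (b *m s)] is an [s]-conjugate of a reflection, so it preserves the coroots. *)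
Lemma weyl_refl a : a \in Phi D -> weyl (refl_mx a (coroot D a)).
Proof.
move=> aP; set s := refl_mx _ _.
have ss : s *m s = 1%:M by apply/refl_mxK/pair_coroot.
suff hs : weyl_half s by split=> //; exists s.
move=> b bP; have bsP := refl_root aP bP; split=> //.
apply: coroot_unique => //; first by rewrite -pair_mulmx pair_coroot.
move=> d dP.
by rewrite refl_mx_conj // -!mulmxA; do 3 apply: refl_is_coroot => //.
Qed.

Lemma weyl_minuscule M x : weyl M -> minuscule D x -> minuscule D (M *m x).
Proof. by move=> [hM _] xmin a /hM[aM _]; rewrite -pair_mulmx xmin. Qed.

Lemma refl_mul_eq M a : weyl M -> a \in Phi D ->
  refl_mx a (coroot D a) *m M = M *m refl_mx (a *m M) (coroot D (a *m M)).
Proof.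
move=> [hM _] /hM[_ e]; rewrite /refl_mx mulmxBl mulmxBr mul1mx mulmx1.
by rewrite -{1}e !mulmxA.
Qed.

End Coroots.

(** * Affine transformations, affine roots and affine reflections *)

Section AffineGroup.
Variables (n : nat).
Implicit Types (x y z : aff n) (c : aff_root n).

Lemma affMA : associative (@affM n).
Proof. by move=> x y z; rewrite /affM /= mulmxDr !mulmxA addrA. Qed.

Lemma aff1M : left_id (aff1 n) (@affM n).
Proof. by case=> v M; rewrite /affM /= !mul1mx add0r. Qed.

Lemma affM1 : right_id (aff1 n) (@affM n).
Proof. by case=> v M; rewrite /affM /= mulmx0 addr0 mulmx1. Qed.

(* The affine function [c o x]. *)
Definition pullback c x : aff_root n := (c.1 *m x.2, c.2 + pair c.1 x.1).

Lemma pullbackM c x y : pullback c (affM x y) = pullback (pullback c x) y.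
Proof. by rewrite /pullback /= mulmxA pairDr pair_mulmx addrA. Qed.

Lemma pullback1 c : pullback c (aff1 n) = c.
Proof. by case: c => a k; rewrite /pullback /= mulmx1 pair0r addr0. Qed.

Definition aff_rootN c : aff_root n := (- c.1, - c.2).

Lemma pullbackN c x : pullback (aff_rootN c) x = aff_rootN (pullback c x).
Proof. by rewrite /pullback /aff_rootN /= mulNmx pairNl opprD. Qed.

End AffineGroup.

Section RealEvaluation.
Variables (R : realType) (n : nat).
Implicit Types (x : aff n) (c : aff_root n) (v : 'cV[R]_n).

Lemma pair_intr (a : 'rV[int]_n) (w : 'cV[int]_n) :
  pair (map_mx intr a) (map_mx intr w) = (pair a w)%:~R :> R.
Proof. by rewrite /pair -map_mxM mxE. Qed.

Lemma aff_eval_pullback c x v :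
  aff_eval (pullback c x) v = aff_eval c (aff_act x v).
Proof.
rewrite /aff_eval /aff_act /pullback /= map_mxM pair_mulmx pairDr pair_intr.
by rewrite rmorphD /=; ring.
Qed.

Lemma aff_evalN c v : aff_eval (aff_rootN c) v = - aff_eval c v.
Proof. by rewrite /aff_eval /= map_mxN pairNl rmorphN opprD. Qed.

End RealEvaluation.

Section AffineReflections.
Variables (n : nat) (D : root_datum n).
Implicit Types (x y z : aff n) (b c : aff_root n).

Lemma aff_reflN c : is_aff_root D c -> aff_refl D (aff_rootN c) = aff_refl D c.
Proof.
move=> cP; rewrite /aff_refl /= corootN // refl_mxNN.
by rewrite scalerN scaleNr opprK.
Qed.

Lemma aff_reflK c : is_aff_root D c ->
  affM (aff_refl D c) (aff_refl D c) = aff1 n.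
Proof.
move=> cP; rewrite /affM /= refl_mxK ?pair_coroot // mul_refl.
rewrite pairNr pairZr pair_coroot // -scaleNr -scalerBl -scalerDl.
by congr (_, _); rewrite -[RHS](scale0r (coroot D c.1)); congr (_ *: _); ring.
Qed.

Lemma refl_affM c x : weyl D x.2 -> is_aff_root D c ->
  affM (aff_refl D c) x = affM x (aff_refl D (pullback c x)).
Proof.
move=> xW cP; rewrite /affM /= refl_mul_eq //; congr (_, _).
have [hx _] := xW; have [_ e] := hx _ cP.
rewrite mul_refl mulmxN -scalemxAr e scalerDl opprD.
by rewrite addrCA !addrA.
Qed.

Lemma pullback_root c x : weyl D x.2 -> is_aff_root D c ->
  is_aff_root D (pullback c x).
Proof. by move=> [hx _] /hx[]. Qed.

Lemma pullback_surj x b : weyl D x.2 -> is_aff_root D b ->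
  exists2 c, is_aff_root D c & pullback c x = b.
Proof.
move=> [_ [N [hN _ NM]]] bP; have [bN _] := hN _ bP.
exists (b.1 *m N, b.2 - pair (b.1 *m N) x.1) => //.
by rewrite /pullback /= -mulmxA NM mulmx1 subrK; case: (b).
Qed.

Lemma weyl_aff_cancel x y z : weyl D x.2 -> affM x y = affM x z -> y = z.
Proof.
move=> [_ [N [_ _ NM]]]; case: y z => [y u] [z v] [/addrI e1 e2].
by rewrite -[y]mul1mx -[u]mul1mx -NM -!mulmxA e1 e2 !mulmxA NM !mul1mx.
Qed.

Lemma gen_ind (S : aff n -> Prop) (Q : aff n -> Prop) x :
  Q (aff1 n) -> (forall t y, S t -> Q y -> Q (affM t y)) -> gen S x -> Q x.
Proof.
move=> Q1 QM [ts [hts <-]]; elim: ts hts => [//|t ts ih] hts /=.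
apply: QM; first by apply: hts; rewrite mem_head.
by apply: ih => s sts; apply: hts; rewrite in_cons sts orbT.
Qed.

Lemma weyl_gen (S : aff n -> Prop) x :
  (forall t, S t -> weyl D t.2) -> gen S x -> weyl D x.2.
Proof.
move=> hS; apply: (gen_ind (Q := fun x => weyl D x.2)).
  exact: weyl1.
by move=> t y /hS; apply: weylM.
Qed.

Lemma finW_weyl K x : root_subsystem D K -> finW D K x -> weyl D x.2.
Proof.
move=> hK; apply: weyl_gen => _ [a aK ->]; apply: weyl_refl.
exact: subsystem_root aK.
Qed.

Lemma finW_fix0 K x : finW D K x -> x.1 = 0.
Proof.
apply: (gen_ind (Q := fun x => x.1 = 0)) => // _ y [a _ ->] /= ->.
by rewrite mulmx0 scale0r addr0 oppr0.
Qed.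

Lemma extW_weyl x : extW D x -> weyl D x.2.
Proof.
case=> v [w [hw ->]] /=; rewrite mul1mx; apply: finW_weyl hw.
exact: Phi_subsystem.
Qed.

End AffineReflections.

(** * Positive affine roots, the exchange condition and Bruhat edges *)

Section Exchange.
Variables (R : realType) (n : nat) (D : root_datum n) (P : {fset 'rV[int]_n}).
Hypothesis hP : positive_system D P.
Implicit Types (x y z s t : aff n) (b c : aff_root n) (a : 'rV[int]_n).

Lemma posP_root a : a \in P -> a \in Phi D.
Proof. by case: hP => xi [_ e]; rewrite e => /andP[]. Qed.

Lemma posPN a : a \in Phi D -> (- a \in P) = (a \notin P).
Proof.
case: hP => xi [xi0 e] aP; rewrite !e PhiN aP /= pairNl oppr_gt0 -leNgt.
by rewrite le_eqVlt (negPf (xi0 _ aP)).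
Qed.

(** A boolean form of positivity: roots of [P] take values strictly between 0 and 1 on the base
    alcove, so for [a] in [P] and an integer [k], [a + k] is positive there iff [0 <= k], and
    [- a + k] iff [1 <= k]. *)
Definition posb c := (c.1 \in P) && (0 <= c.2) || (- c.1 \in P) && (1 <= c.2).

Lemma posb_root c : posb c -> is_aff_root D c.
Proof.
rewrite /is_aff_root.
by case/orP => /andP[/posP_root]; rewrite ?PhiN.
Qed.

Lemma posb_ge0 c : posb c -> 0 <= c.2.
Proof. by case/orP => /andP[_ // +]; lia. Qed.

Lemma posbN c : is_aff_root D c -> posb (aff_rootN c) = ~~ posb c.
Proof.
move=> cP; rewrite /posb /= opprK (posPN cP).
by case: (c.1 \in P) => /=; lia.
Qed.

Lemma posb_eval c (v : 'cV[R]_n) : posb c -> closed_base_alcove P v ->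
  0 <= aff_eval c v.
Proof.
rewrite /aff_eval => + hv.
case/orP => /andP[/hv/andP[v0 v1] c0].
  by rewrite addr_ge0 // ler0z.
move: v1; rewrite map_mxN pairNl => v1.
have : 1 <= c.2%:~R :> R by rewrite ler1z.
lra.
Qed.

Lemma posb_eval_gt0 c (v : 'cV[R]_n) : posb c -> base_alcove P v ->
  0 < aff_eval c v.
Proof.
rewrite /aff_eval => + hv.
case/orP => /andP[/hv/andP[v0 v1] c0].
  by rewrite ltr_pwDl // ler0z.
move: v1; rewrite map_mxN pairNl => v1.
have : 1 <= c.2%:~R :> R by rewrite ler1z.
lra.
Qed.

Lemma base_alcove_neq0 : exists v : 'cV[R]_n, base_alcove P v.
Proof.
case: hP => xi [_ e].
(* [m] exceeds [<a, xi>] for all [a] in [P], so [xi / m] lies in the base alcove. *)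
pose m : int := 1 + \sum_(a <- P) `|pair a xi|.
have m_gt a : a \in P -> `|pair a xi| < m.
  move=> aP; rewrite /m (big_fsetD1 a) //= addrCA ltrDl.
  by rewrite ltr_pwDl // sumr_ge0.
have m0 : 0 < m by rewrite /m ltr_pwDl // sumr_ge0.
exists (m%:~R^-1 *: map_mx intr xi) => a aP; rewrite pairZr pair_intr.
move: (m_gt _ aP); rewrite e in aP; case/andP: aP => _ a0.
rewrite gtr0_norm // => am.
rewrite mulr_gt0 ?invr_gt0 ?ltr0z //= mulrC.
by rewrite ltr_pdivrMr ?ltr0z // mul1r ltr_int.
Qed.

Lemma positiveP c : is_aff_root D c ->
  reflect (positive_aff_root R D P c) (posb c).
Proof.
move=> cP; apply: (iffP idP) => [c0 | [_ c0]].
  by split=> // v; apply: posb_eval_gt0.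
apply/negPn; rewrite -posbN //; apply/negP => cN.
have [v hv] := base_alcove_neq0.
by have := posb_eval_gt0 cN hv; rewrite aff_evalN oppr_gt0 ltNge ltW ?c0.
Qed.

Lemma simple_weyl s : simple_refl R D P s -> weyl D s.2.
Proof. by case=> b [bP _] ->; apply: weyl_refl. Qed.

Lemma Waff_weyl x : Waff R D P x -> weyl D x.2.
Proof. exact/weyl_gen/simple_weyl. Qed.

(** The wall point [v] is fixed by [s_b], so [c] and [- (c o s_b)], both nonnegative on the closed
    alcove, take opposite values at [v]. Hence [c] vanishes at [v], which lies on the hyperplane of
    [b] only. *)
Lemma simple_refl_flip b c : is_wall R D P b -> posb c ->
  ~~ posb (pullback c (aff_refl D b)) -> c = b \/ c = aff_rootN b.
Proof.
case=> bP [v [hv bv hb]] c0 cN; have cP := posb_root c0; apply: hb => //.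
have sv : aff_act (aff_refl D b) v = v.
  rewrite /aff_act /= /refl_mx map_mxB map_mx1 map_mxM mulmxBl mul1mx.
  move/eqP: bv; rewrite /aff_eval addr_eq0 outer_mulmx => /eqP ->.
  by rewrite map_mxN map_mxZ scaleNr opprK addrCA addNr addr0.
apply/eqP; rewrite eq_le posb_eval // andbT -sv -aff_eval_pullback.
rewrite -oppr_ge0 -aff_evalN posb_eval // posbN //.
by apply: pullback_root => //; apply: weyl_refl.
Qed.

(** The strong exchange condition. Pull [c] back letter by letter: the first letter that makes it
    negative is, by [simple_refl_flip], the reflection of the current root, and multiplying by [s_c]
    on the left deletes that letter. *)
Lemma exchange ts c : (forall s, s \in ts -> simple_refl R D P s) -> posb c ->
  ~~ posb (pullback c (word_prod ts)) ->
  exists2 ts', (size ts' < size ts)%N &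
    is_word (simple_refl R D P) ts' (affM (aff_refl D c) (word_prod ts)).
Proof.
elim: ts c => [|s ts ih] c hts c0 /=; first by rewrite pullback1 c0.
have hs : simple_refl R D P s by apply: hts; rewrite mem_head.
have hts' t : t \in ts -> simple_refl R D P t.
  by move=> tts; apply: hts; rewrite in_cons tts orbT.
have cP := posb_root c0.
rewrite pullbackM.
have [cs0 /(ih _ hts' cs0)|csN _] := boolP (posb (pullback c s)).
  case=> us us_lt [hus e]; exists (s :: us) => //; split.
    by move=> t; rewrite in_cons => /predU1P[->|/hus].
  by rewrite /= e !affMA refl_affM //; apply: simple_weyl.
exists ts => //; split=> //; have [b hb es] := hs; have [bP _] := hb.
rewrite affMA; suff -> : aff_refl D c = s by rewrite es aff_reflK // aff1M.
rewrite es in csN; rewrite es.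
by have [->|->] := simple_refl_flip hb c0 csN; rewrite ?aff_reflN.
Qed.

Lemma len_min ts x : is_word (simple_refl R D P) ts x ->
  (len R D P x <= size ts)%N.
Proof.
move=> hts; rewrite /len; case: pselect => // h.
by case: ex_minnP => m _; apply; apply/asboolP; exists ts.
Qed.

Lemma len_word x : Waff R D P x ->
  exists2 ts, size ts = len R D P x & is_word (simple_refl R D P) ts x.
Proof.
move=> [ts hts]; rewrite /len; case: pselect => [h|[]]; last first.
  by exists (size ts); apply/asboolP; exists ts.
by case: ex_minnP => m /asboolP[us us_m hus] _; exists us.
Qed.

(* [x < s_c x], with [c] and [x^-1 c] both positive. *)
Definition up x y := weyl D x.2 /\ exists c,
  [/\ posb c, posb (pullback c x) & y = affM (aff_refl D c) x].

(** Write [v = s_c u] with [u^-1 c] positive. If [c] were negative, exchange applied to [- c] would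
    give [v] a word shorter than the length of [u]. Left multiplication by [s] preserves this, since
    [s] maps the base alcove onto itself and so preserves positivity. *)
Lemma bruhat_edge_up s u v : Omega R D P s -> bruhat_edge R D P u v ->
  up (affM s u) (affM s v).
Proof.
move=> [/extW_weyl sW s_alcove] [uWaff _ uv [_ [_ [b0 b0P ->] ev]]].
have uW := Waff_weyl uWaff.
have [b [b_pos eb]] : exists b, posb b /\ aff_refl D b = aff_refl D b0.
  have [b0_pos|b0N] := boolP (posb b0); first by exists b0.
  by exists (aff_rootN b0); rewrite posbN // aff_reflN.
have bP := posb_root b_pos.
have [c cP ecb] := pullback_surj uW bP.
have ev' : v = affM (aff_refl D c) u by rewrite refl_affM // ecb eb.
have c_pos : posb c.
  apply/negPn/negP => cN; have [ts ts_len [hts ets]] := len_word uWaff.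
  have [||ts' ts'_lt] := exchange (c := aff_rootN c) hts; rewrite ?posbN //.
    by rewrite pullbackN ets ecb posbN // b_pos.
  rewrite aff_reflN // ets -ev' => /len_min le_v; move: uv.
  by rewrite ltnNge -ts_len ltnW // (leq_ltn_trans le_v).
have [d dP ecd] := pullback_surj sW cP.
split; first exact: weylM.
exists d; split; last by rewrite affMA refl_affM // ecd -affMA -ev'.
  apply/(positiveP dP); split=> // v'; rewrite -s_alcove => -[v0 hv0 <-].
  by rewrite -aff_eval_pullback ecd; apply: posb_eval_gt0.
by rewrite pullbackM ecd ecb.
Qed.

End Exchange.

(** * Descent of the image of the origin along the Bruhat order *)

Section MinusculeDescent.
Variables (R : realType) (n : nat) (D : root_datum n) (P : {fset 'rV[int]_n}).
Hypothesis hP : positive_system D P.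
Variable xi : 'cV[int]_n.
Hypothesis xi_gt0 : forall a, a \in P -> 0 < pair a xi.
Implicit Types (x y : aff n) (v : 'cV[int]_n) (a : 'rV[int]_n).

(** The Weyl-invariant form [\sum_b <b, v> <b, w>] at [w = xi]: an integer that subtracting a
    positive coroot strictly lowers. *)
Definition height v : int := \sum_(b <- Phi D) pair b v * pair b xi.

Lemma heightD v w : height (v + w) = height v + height w.
Proof.
by rewrite /height -big_split; apply: eq_bigr => b _; rewrite pairDr mulrDl.
Qed.

(* Invariance of the form [\sum_b <b, v> <b, w>] under [s_a] turns            *)
(* [2 * height (coroot a)] into [<a, xi> * \sum_b <b, coroot a> ^ 2].         *)
Lemma height_coroot_gt0 a : a \in P -> 0 < height (coroot D a).
Proof.
move=> aP; have aPhi := posP_root hP aP; set c := coroot D a.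
set q : int := \sum_(b <- Phi D) pair b c ^+ 2.
have q_gt0 : 0 < q.
  rewrite /q (big_fsetD1 a) //= ltr_pwDl ?pair_coroot //.
  by apply: sumr_ge0 => b _; apply: sqr_ge0.
have e : height c = - height c + pair a xi * q.
  rewrite {1}/height -[in LHS](refl_Phi aPhi) big_imfset /=; last first.
    move=> b b' _ _; have cK := refl_mxK (pair_coroot aPhi).
    by move/(congr1 (mulmx^~ (refl_mx a c))); rewrite -!mulmxA cK !mulmx1.
  rewrite /height /q mulr_sumr -sumrN -big_split; apply: eq_bigr => b _ /=.
  by rewrite refl_mul !pairE pair_coroot //; ring.
have := mulr_gt0 (xi_gt0 aP) q_gt0.
by move: e; lia.
Qed.

Lemma up_minuscule x y : up D P x y -> minuscule D y.1 ->
  [/\ minuscule D x.1, height y.1 <= height x.1 &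
      height y.1 = height x.1 -> x.1 = y.1].
Proof.
move=> [_ [[a m] [/= c_pos cx_pos ->]]] /=; have aP := posb_root hP c_pos.
have := posb_ge0 cx_pos; have := posb_ge0 c_pos; rewrite /= mul_refl => m0.
set k := m + _ => k0 ymin.
have ey : - (m *: coroot D a) + (x.1 - pair a x.1 *: coroot D a)
    = x.1 - k *: coroot D a by rewrite /k scalerDl opprD addrCA.
move: ymin; rewrite ey => ymin.
(* Here [<a, y(0)> = - (k + m)] with [k] and [m] nonnegative, so minusculity gives [k + m <= 1]. *)
have ax := ymin _ aP; rewrite !pairE pair_coroot // !inE in ax.
have [k_eq0|k_neq0] := eqVneq k 0.
  by move: ymin; rewrite k_eq0 scale0r subr0.
have [k1 m_eq0] : k = 1 /\ m = 0.
  move: m0 k0 k_neq0 ax; rewrite /k; set p : int := pair a x.1; lia.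
have a_pos : a \in P by case/orP: c_pos => /= /andP[] //; rewrite m_eq0.
rewrite k1 scale1r in ymin *; have ec := height_coroot_gt0 a_pos.
(* As [<a, x(0)> = 1], the point [x(0)] is the reflection of [y(0)], hence minuscule too. *)
have ex : x.1 = refl_mx a (coroot D a) *m (x.1 - coroot D a).
  rewrite mul_refl !pairE pair_coroot //.
  have -> : pair a x.1 = 1 by rewrite /k m_eq0 in k1; lia.
  by rewrite (_ : 1 - 2 = -1) // scaleN1r opprK subrK.
have eh : height x.1 = height (x.1 - coroot D a) + height (coroot D a).
  by rewrite -heightD subrK.
split.
- by rewrite ex; apply: weyl_minuscule => //; apply: weyl_refl.
- by rewrite eh lerDl ltW.
by move/eqP; rewrite lt_eqF // [ltRHS]eh ltrDl.
Qed.

(** Minusculity passes down the chain from [y], and heights are monotone along it; equal heights at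
    the ends squeeze all those between, so the equality clauses compose. *)
Lemma bruhat_le_minuscule x y : bruhat_le R D P x y -> minuscule D y.1 ->
  [/\ minuscule D x.1, height y.1 <= height x.1 &
      height y.1 = height x.1 -> x.1 = y.1].
Proof.
move=> [s [u [v [hs -> -> [_ _ uv]]]]].
elim: uv => [{}u {}v /(bruhat_edge_up hP hs)/up_minuscule//|//|].
move=> {}u z {}v _ ihu _ ihv /ihv[zmin hz ez]; have [umin hu eu] := ihu zmin.
split=> //; first exact: le_trans hz hu.
move=> e; have huz : height (affM s z).1 = height (affM s u).1.
  by apply/eqP; rewrite eq_le hu -e hz.
by rewrite eu // ez // huz e.
Qed.

Lemma bruhat_path_minuscule x ts y : weyl D x.2 -> bruhat_path R D P x ts y ->
  minuscule D y.1 ->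
  [/\ minuscule D x.1, height y.1 <= height x.1 &
      height y.1 = height x.1 -> forall t, t \in ts -> t.1 = 0].
Proof.
elim: ts x => [|t ts ih] x xW /=; first by move->.
move=> [[tW _] [x_le _] hpath] ymin.
have xtW : weyl D (affM x t).2 by apply: weylM => //; apply: Waff_weyl tW.
have [xtmin hxt ext] := ih _ xtW hpath ymin.
have [xmin hx ex] := bruhat_le_minuscule x_le xtmin.
split=> //; first exact: le_trans hxt hx.
move=> e; have hxxt : height (affM x t).1 = height x.1.
  by apply/eqP; rewrite eq_le hx -e hxt.
move=> t' /predU1P[->|]; last by apply: ext; rewrite hxxt.
(* [x t] and [x] agree at the origin, so the translation by [t.1] can be cancelled after [x]. *)
have exy : affM x (t.1, 1%:M) = affM x (aff1 n).
  by rewrite /affM /= mulmx0 addr0; congr (_, _); apply/esym/ex.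
by have [] := weyl_aff_cancel xW exy.
Qed.

End MinusculeDescent.

Lemma bruhat_path_reflection (R : realType) n (D : root_datum n) P x ts y t :
  bruhat_path R D P x ts y -> t \in ts -> reflection R D P t.
Proof.
elim: ts x => // s ts ih x [hs _ /ih h]; rewrite in_cons.
by case/predU1P => [->|/h].
Qed.

(** * Generic points of a hyperplane and the reflections in [W_K] *)

Lemma generic_vector n (a : 'rV[int]_n) (s : seq 'rV[int]_n) :
  (forall b, b \in s -> exists2 x, pair a x = 0 & pair b x != 0) ->
  exists2 x, pair a x = 0 & forall b, b \in s -> pair b x != 0.
Proof.
elim: s => [|b s ih] hs; first by exists 0; rewrite ?pair0r.
have [c cs|x ax xs] := ih; first by apply: hs; rewrite in_cons cs orbT.
have [bx|bx] := eqVneq (pair b x) 0; last first.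
  by exists x => // c /predU1P[->|/xs].
have [y ay by0] := hs _ (mem_head _ _).
(* [N] exceeds every [|<c, y>|], while the nonzero integers [<c, x>] have absolute value at least 1;
   so adding [y] to [N *: x] cannot cancel any [<c, N *: x>]. *)
pose N : int := 1 + \sum_(c <- s) `|pair c y|.
exists (N *: x + y) => [|c]; first by rewrite !pairE ax ay mulr0 addr0.
rewrite !pairE => /predU1P[->|cs]; first by rewrite bx mulr0 add0r.
have N_gt : `|pair c y| < N.
  by rewrite /N (big_rem c) //= addrCA ltrDl ltr_pwDl // sumr_ge0.
have N_gt0 : 0 < N by apply: le_lt_trans N_gt.
apply/eqP => e; have := xs _ cs; rewrite -normr_gt0 => cx.
suff : `|N * pair c x| < N.
  by rewrite normrM gtr0_norm // ltNge ler_peMr // ?ltW // -gtz0_ge1.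
by move/eqP: e; rewrite addr_eq0 => /eqP ->; rewrite normrN.
Qed.

Section ReflectionsInSubgroup.
Variables (n : nat) (D : root_datum n) (P : {fset 'rV[int]_n}).
Hypothesis hP : positive_system D P.
Implicit Types (a b g : 'rV[int]_n) (x y : 'cV[int]_n) (K : {fset 'rV[int]_n}).

Lemma roots_not_proportional a b : a \in Phi D -> b \in Phi D ->
  b != a -> b != - a -> exists2 x, pair a x = 0 & pair b x != 0.
Proof.
move=> aP bP ba bNa.
pose p := pair b (coroot D a); pose q := pair a (coroot D b).
(* Twice the projection of the [i]-th basis vector to the hyperplane of [a] along [a^vee]. If [b]
   kills all of these, then [2 b = p a]. *)
pose y i : 'cV[int]_n :=
  2 *: delta_mx i 0 - pair a (delta_mx i 0) *: coroot D a.
have ay i : pair a (y i) = 0 by rewrite !pairE pair_coroot //; ring.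
have [[i bi]|nb] := pselect (exists i, pair b (y i) != 0).
  by exists (y i).
have e2 : b *+ 2 = p *: a.
  apply/rowP => i; apply/eqP; rewrite -subr_eq0; apply/negPn/negP => h.
  apply: nb; exists i; rewrite !pairE !pair_delta -/p.
  by apply: contraNN h => /eqP h; apply/eqP; rewrite -h mulr2n !mxE; ring.
have pq : 4 = p * q by rewrite -pairZl -e2 mulr2n pairDl pair_coroot.
have half u v : u *+ 2 = v *+ 2 -> u = v :> 'rV[int]_n.
  move=> /rowP e; apply/rowP => i; have := e i; rewrite !mulr2n !mxE.
  by set p1 : int := u 0 i; set p2 : int := v 0 i; lia.
(* [p] divides 4. The values 2 and -2 give [b = a] and [b = - a]; the others make one root plus or
   minus twice the other, against reducedness. *)
have : p \in [:: 1; -1; 2; -2; 4; -4].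
  rewrite !inE; have : (p %| 4%R)%Z by rewrite pq dvdz_mulr.
  by case: (p) => [[|[|[|[|[|k]]]]]|[|[|[|[|k]]]]] // /dvdn_leq => /(_ isT).
rewrite !inE; case/or4P => [/eqP pE|/eqP pE|/eqP pE|/or3P[]/eqP pE].
- by have := Phi_reduced bP; rewrite e2 pE scale1r aP.
- by have := Phi_reduced bP; rewrite e2 pE scaleN1r PhiN aP.
- by case/eqP: ba; apply: half; rewrite e2 pE scaler_nat.
- by case/eqP: bNa; apply: half; rewrite e2 pE scaleNr scaler_nat mulNrn.
- have := Phi_reduced aP; rewrite (_ : a *+ 2 = b) ?bP //.
  by apply: half; rewrite e2 pE -mulrnA scaler_nat.
- have := Phi_reduced aP; rewrite (_ : a *+ 2 = - b) ?PhiN ?bP //.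
  by apply: half; rewrite mulNrn e2 pE scaleNr opprK -mulrnA scaler_nat.
Qed.

(** On the positive roots of a subsystem [K] this is the anti-invariant polynomial of [W_K]; at
    [K]-regular points it detects the parity of words in reflections. *)
Definition pos_prod (A : {fset 'rV[int]_n}) x : int := \prod_(b <- A) pair b x.

(* [x |-> pos_prod A (s_g x)] is [pos_prod A] up to a sign, and that sign is  *)
(* seen at a point of the hyperplane of [g] where [pos_prod A] is nonzero.    *)
Lemma pos_prod_sym (A : {fset 'rV[int]_n}) g x : g \in Phi D ->
  A `<=` P -> g \notin A -> - g \notin A ->
  (forall b, b \in A -> let b' := b *m refl_mx g (coroot D g) in
     (b' \in A) || (- b' \in A)) ->
  pos_prod A (refl_mx g (coroot D g) *m x) = pos_prod A x.
Proof.
move=> gP /fsubsetP AP gA NgA; set s := refl_mx _ _ => hA.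
have ss : s *m s = 1%:M by apply/refl_mxK/pair_coroot.
(* [f] sends [b] to whichever of [b s] and [- b s] lies in [A], and so permutes [A]; [e] records the
   sign. *)
pose e b : int := if b *m s \in A then 1 else -1.
pose f b := e b *: (b *m s).
have fA b : b \in A -> f b \in A.
  move=> /hA; rewrite /f /e; case: ifP => [+ _|_]; first by rewrite scale1r.
  by rewrite /= scaleN1r.
have ANA b : b \in A -> - b \notin A.
  move=> bA; apply/negP => /AP NbP.
  by rewrite (posPN hP) ?AP ?(posP_root hP) ?AP // in NbP.
have f_inj : {in A &, injective f}.
  move=> b b' bA b'A /(congr1 (mulmx^~ s)).
  rewrite -!scalemxAl -!mulmxA ss !mulmx1 /e.
  case: ifP; case: ifP => _ _; rewrite ?scale1r ?scaleN1r //.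
  - by move=> h; move: (ANA _ b'A); rewrite -h bA.
  - by move=> h; move: (ANA _ bA); rewrite h b'A.
  - by move/oppr_inj.
have eA : [fset f b | b in A] = A.
  apply/eqP; rewrite eqEfcard card_in_imfset // leqnn andbT.
  by apply/fsubsetP => _ /imfsetP[b /= /fA + ->].
have sgn y : pos_prod A (s *m y) = (\prod_(b <- A) e b) * pos_prod A y.
  have -> : pos_prod A y = \prod_(b <- A) pair (f b) y.
    by rewrite -{1}eA /pos_prod big_imfset.
  rewrite -big_split /=.
  apply: eq_bigr => b _; rewrite /f pairZl pair_mulmx mulrA.
  by rewrite /e; case: ifP => _; rewrite ?mulrNN !mul1r.
have [z gz Az] : exists2 z, pair g z = 0 & forall b, b \in A -> pair b z != 0.
  apply: generic_vector => b bA; apply: roots_not_proportional => //.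
  - exact/(posP_root hP)/AP.
  - by apply: contraNneq gA => <-.
  - by apply: contraNneq NgA => <-.
have : pos_prod A z != 0.
  by rewrite /pos_prod prodf_seq_neq0; apply/allP => b /Az.
move: (sgn z); rewrite mul_refl gz scale0r subr0 => ez Az0.
rewrite sgn -[RHS]mul1r; congr (_ * _).
by apply: (mulIf Az0); rewrite mul1r -ez.
Qed.

(** Since [s_g] is also the reflection of [- g], one may take [g] positive. The factor of [g]
    changes sign, and [pos_prod_sym] handles the remaining factors, which [s_g] permutes up to
    sign. *)
Lemma pos_prod_anti K g x : root_subsystem D K -> g \in K ->
  pos_prod (K `&` P) (refl_mx g (coroot D g) *m x) = - pos_prod (K `&` P) x.
Proof.
move=> hK; wlog gP : g / g \in P => [hwlog gK|gK].
  have gPhi := subsystem_root hK gK.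
  have [gP|gP] := boolP (g \in P); first exact: hwlog.
  by rewrite -refl_mxNN -corootN // hwlog ?(subsystemN _ hK) ?(posPN hP).
have gPhi := subsystem_root hK gK.
have gKP : g \in K `&` P by rewrite inE gK.
rewrite /pos_prod !(big_fsetD1 g gKP) /= -mulNr; congr (_ * _).
  by rewrite mul_refl !pairE pair_coroot //; ring.
apply: pos_prod_sym => //; rewrite ?inE ?eqxx //=.
- by apply/fsubsetP => b; rewrite !inE => /and3P[].
- by rewrite (posPN hP) // gP !andbF.
move=> b; rewrite !inE => /and3P[bg bK bP].
have bPhi := subsystem_root hK bK; have b'K := subsystem_refl hK gK bK.
set b' := b *m _ in b'K *; have b'Phi := subsystem_root hK b'K.
rewrite (subsystemN _ hK) b'K /= (posPN hP) //.
have ss := refl_mxK (pair_coroot gPhi).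
have gs : g *m refl_mx g (coroot D g) = - g.
  by rewrite refl_mul pair_coroot // scaler_nat mulr2n opprD addNKr.
have b'g : b' != g.
  apply/eqP => /(congr1 (mulmx^~ (refl_mx g (coroot D g)))).
  rewrite /b' -mulmxA ss mulmx1 gs => e.
  by move: bP; rewrite e (posPN hP) // gP.
have b'Ng : - b' != g.
  apply: contraNneq bg => /(congr1 (mulmx^~ (refl_mx g (coroot D g)))).
  by rewrite mulNmx /b' -mulmxA ss mulmx1 gs => /oppr_inj ->.
by rewrite b'g b'Ng /=; case: (b' \in P).
Qed.

Lemma pos_prod_word K ts t x : root_subsystem D K ->
  is_word (fun t => exists2 a, a \in K & t = aff_refl D (a, 0)) ts t ->
  pos_prod (K `&` P) (t.2 *m x) = (-1) ^+ size ts * pos_prod (K `&` P) x.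
Proof.
move=> hK [hts <-]; elim: ts hts => [|s ts ih] hts /=.
  by rewrite mul1mx mul1r.
have [a aK ->] := hts _ (mem_head _ _).
rewrite -mulmxA pos_prod_anti // ih ?exprS ?mulN1r ?mulNr // => u uts.
by apply: hts; rewrite in_cons uts orbT.
Qed.

Lemma pos_prod_neq0 K x : root_subsystem D K ->
  (forall b, b \in K -> pair b x != 0) -> pos_prod (K `&` P) x != 0.
Proof.
move=> hK xK; rewrite prodf_seq_neq0; apply/allP => b /=.
by rewrite !inE => /andP[/xK].
Qed.

(* If [a \notin K], then [s_a] fixes a [K]-regular point, so by [pos_prod] of *)
(* [K] it is a product of evenly many reflections; [pos_prod] of [Phi] says   *)
(* the opposite.                                                              *)
Lemma finW_refl K a : root_subsystem D K -> a \in Phi D ->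
  finW D K (aff_refl D (a, 0)) -> a \in K.
Proof.
move=> hK aP [ts hts]; apply/negPn/negP => aK.
have hPhi := Phi_subsystem D.
have odd_ts : (-1) ^+ size ts = -1 :> int.
  have [xi [xi0 _]] := hP.
  have xi_prod := pos_prod_neq0 hPhi xi0.
  apply: (mulIf xi_prod).
  rewrite -(pos_prod_word xi hPhi (t := aff_refl D (a, 0))).
    by rewrite /= pos_prod_anti // mulN1r.
  case: hts => hts e; split=> // t /hts[b bK ->]; exists b => //.
  exact: subsystem_root bK.
have [z az Kz] : exists2 z, pair a z = 0 & forall b, b \in K -> pair b z != 0.
  apply: generic_vector => b bK; apply: roots_not_proportional => //.
  - exact: subsystem_root bK.
  - by apply: contraNneq aK => <-.
  - by apply: contraNneq aK => e; rewrite -(subsystemN _ hK) -e.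
have z_prod := pos_prod_neq0 hK Kz.
have := pos_prod_word z hK hts.
by rewrite /= odd_ts mul_refl az scale0r subr0 mulN1r; lia.
Qed.

End ReflectionsInSubgroup.

(** Taking linear parts letter by letter; hence an element of [W_{J,aff}] that fixes the origin lies
    in [W_J]. *)
Lemma affW_linear_part n (D : root_datum n) K t :
  affW D K t -> finW D K (0, t.2).
Proof.
apply: (gen_ind (Q := fun t => finW D K (0, t.2))); first by exists [::].
move=> _ y [b bK ->] [ts [hts e]]; exists (aff_refl D (b.1, 0) :: ts); split.
  by move=> s /predU1P[->|/hts //]; exists b.1.
by rewrite /= e /affM /= mulmx0 scale0r oppr0 addr0.
Qed.

(** * Existence and uniqueness of the minimal subsystem *)

Theorem lemma4p18 (R : realType) (n : nat) (D : root_datum n)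
    (P : {fset 'rV[int]_n}) (hP : positive_system D P)
    (mu : 'cV[int]_n) (hdom : dominant P mu) (hmin : minuscule D mu)
    (prec : aff_root n -> aff_root n -> Prop)
    (hprec : reflection_order R D P prec)
    (lam : 'cV[int]_n) (wbar : aff n) (hwbar : finW D (Phi D) wbar)
    (hw : Adm R D P mu (affM (transl lam) wbar))
    (J : {fset 'rV[int]_n}) (hJ : root_subsystem D J)
    (Delta : seq (aff n))
    (hDelta : BJ R D P prec J (affM (transl lam) wbar) (transl lam) Delta) :
  exists! JDelta : {fset 'rV[int]_n}, minimal_carrier D J Delta JDelta.
Proof.
have hPhi := Phi_subsystem D.
have [xi [_ xiP]] := hP.
have xi_gt0 a : a \in P -> 0 < pair a xi by rewrite xiP => /andP[].
have [w_ext [v hv w_le]] := hw; have [w_path w_aff _] := hDelta.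
have w1 : (affM (transl lam) wbar).1 = lam.
  by rewrite /= (finW_fix0 hwbar) mulmx0 addr0.
have [lam_min _ _] := bruhat_le_minuscule hP xi_gt0 w_le
  (weyl_minuscule (finW_weyl hPhi hv) hmin).
rewrite w1 in lam_min.
(* Both ends of the path send the origin to [lam], so the equality clause applies. *)
have [_ _ t_fix0] := bruhat_path_minuscule hP xi_gt0 (extW_weyl w_ext)
  w_path lam_min.
have t_finite t : t \in Delta -> exists2 a, a \in Phi D & t = aff_refl D (a, 0).
  move=> tD; have := t_fix0 (congr1 _ (esym w1)) _ tD.
  have [_ [[a k] aP ->]] := bruhat_path_reflection w_path tD.
  by move=> /= t0; exists a => //; rewrite /aff_refl /= t0 scale0r oppr0.
(* By [finW_refl], carrying the path means containing prescribed roots, a condition stable under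
   intersection. *)
have carriesE K : carries D J Delta K <-> [/\ root_subsystem D K, K `<=` J &
    forall a, a \in Phi D -> aff_refl D (a, 0) \in Delta -> a \in K].
  split=> -[hK KJ h]; first by split=> // a aP /h /(finW_refl hP); apply.
  split=> // t tD.
  have [a aP et] := t_finite _ tD; exists [:: t]; split; last exact: affM1.
  by move=> _ /[1!inE] /eqP ->; exists a => //; apply: h; rewrite -?et.
have carriesJ : carries D J Delta J.
  split=> // t tD; have := affW_linear_part (w_aff _ tD).
  by have [a _ ->] := t_finite _ tD; rewrite /aff_refl /= scale0r oppr0.
(* The intersection of all carriers, cut out of [J] so as to be a finite set; being the least
   carrier, it is the only minimal one. *)
pose K0 := [fset a in J | `[< forall K, carries D J Delta K -> a \in K >]].
have K0P a : reflect (forall K, carries D J Delta K -> a \in K) (a \in K0).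
  rewrite !inE /=; apply: (iffP andP) => [[_ /asboolP]//|h].
  by split; [exact: h | exact/asboolP].
have carriesK0 : carries D J Delta K0.
  apply/carriesE; split.
  - split.
      apply/fsubsetP => a /K0P/(_ _ carriesJ); exact: subsystem_root.
    move=> a /K0P aK0; apply: imfset_fin_surj.
      have aP := subsystem_root hJ (aK0 _ carriesJ).
      move=> b b' /(congr1 (mulmx^~ (refl_mx a (coroot D a)))).
      by rewrite -!mulmxA refl_mxK ?pair_coroot // !mulmx1.
    move=> b /K0P bK0; apply/K0P => K hK; have [Ksub _ _] := hK.
    exact: subsystem_refl (aK0 _ hK) (bK0 _ hK).
  - by apply/fsubsetP => a /K0P; apply.
  - by move=> a aP aD; apply/K0P => K /carriesE[_ _]; apply.
have K0_min K : carries D J Delta K -> K0 `<=` K.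
  by move=> hK; apply/fsubsetP => a /K0P; apply.
exists K0; split.
  split=> // K hK KK0; apply/eqP; rewrite eqEfsubset KK0; exact: K0_min.
by move=> K [hK Kmin]; apply: Kmin => //; apply: K0_min.
Qed.
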